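(* Let $\mu$ be a finite signed charge on a semi-ring $\mathcal{S}$ of subsets of a set $\Omega$. The charges $\mu^+:=\mu\vee 0$ and $\mu^-:=(-\mu)\vee 0$ satisfy $$\mu^+=\mu+\mu^-,\qquad |\mu|=\mu^++\mu^-.$$ If $\mu$ is a finite signed measure, then $\mu^+$ and $\mu^-$ are measures. If one of the charges $\mu^+$ or $\mu^-$ is finite, then so is the other, and in that case $\mu$ is of finite variation and $\mu^+,\mu^-$ are the unique finite charges on $\mathcal{S}$ such that $\mu=\mu^+-\mu^-$ and $\mu^+\wedge\mu^-=0$.
   Context: A semi-ring $\mathcal{S}$ of subsets of $\Omega$ is a family with $\emptyset\in\mathcal{S}$, closed under finite intersections, and such that for $A,B\in\mathcal{S}$ the set $A\setminus B$ is a finite disjoint union of elements of $\mathcal{S}$. $\mathscr{P}(A)$ denotes the family of all finite partitions of $A$ by elements of $\mathcal{S}$. A signed charge on $\mathcal{S}$ is a set function $\mu:\mathcal{S}\to[-\infty,\infty]$ with $\mu(\emptyset)=0$ that avoids at least one of the values $+\infty,-\infty$ and is finitely additive (for finite families of pairwise disjoint elements of $\mathcal{S}$ whose union is in $\mathcal{S}$); a charge is a non-negative signed charge (possibly taking the value $+\infty$). A (signed) measure is a countably additive (signed) charge. Finite means taking only finite values. Signed charges are ordered pointwise on $\mathcal{S}$; $\vee$ and $\wedge$ are given by $(\mu\vee\nu)(A)=\sup_{\Pi\in\mathscr{P}(A)}\sum_{C\in\Pi}\max\{\mu(C),\nu(C)\}$ (the least upper bound among signed charges) and $(\mu\wedge\nu)(A)=\inf_{\Pi\in\mathscr{P}(A)}\sum_{C\in\Pi}\min\{\mu(C),\nu(C)\}$.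 The variation is $|\mu|:=\mu\vee(-\mu)$, and $\mu$ is of finite variation if $|\mu|$ is finite. *)

(* Defs.v *)
From HB Require Import structures.
From mathcomp Require Import all_boot all_order all_algebra.
From mathcomp Require Import all_classical all_reals all_analysis.

Set Implicit Arguments.
Unset Strict Implicit.
Unset Printing Implicit Defensive.

Import Order.TTheory GRing.Theory Num.Theory.
Import numFieldNormedType.Exports.

Local Open Scope classical_set_scope.
Local Open Scope ereal_scope.

(* The semi-ring is a predicate on [set T], with [T] an arbitrary type, because
   [semiRingOfSetsType] requires a point in [T], which would exclude the empty
   base set. *)
Definition semiring_of_sets (T : Type) (S : set (set T)) : Prop :=
  [/\ S set0, setI_closed S & semi_setD_closed S].

(* A set function on [S] is a total function on [set T] of which only the
   values on [S] matter: every condition, equality and finiteness statement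
   below is relative to [S]. *)
Section set_functions.
Context (R : realType) (T : Type) (S : set (set T)).
Implicit Types mu nu : set T -> \bar R.

Definition finite_on mu : Prop := forall A, S A -> mu A \is a fin_num.

Definition finitely_additive_on mu : Prop :=
  forall (n : nat) (F : 'I_n -> set T),
    (forall i, S (F i)) -> trivIset setT F -> S (\bigcup_i F i) ->
    mu (\bigcup_i F i) = \sum_(i < n) mu (F i).

Definition countably_additive_on mu : Prop :=
  forall F : (set T)^nat,
    (forall i, S (F i)) -> trivIset setT F -> S (\bigcup_i F i) ->
    \sum_(0 <= i < n) mu (F i) @[n --> \oo] --> mu (\bigcup_i F i).

Definition signed_charge_on mu : Prop :=
  [/\ mu set0 = 0,
      (forall A, S A -> mu A != +oo) \/ (forall A, S A -> mu A != -oo)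
    & finitely_additive_on mu].

Definition nonnegative_on mu : Prop := forall A, S A -> 0 <= mu A.

Definition charge_on mu : Prop := signed_charge_on mu /\ nonnegative_on mu.

Definition signed_measure_on mu : Prop :=
  signed_charge_on mu /\ countably_additive_on mu.

Definition measure_on mu : Prop := charge_on mu /\ countably_additive_on mu.

(* [partition] asks for nonempty blocks, so the only partition of [set0] is the
   empty one.  Empty blocks would contribute 0 to the sums below, since signed
   charges vanish at [set0]. *)
Definition finite_partitions (A : set T) : set (set (set T)) :=
  [set P | [/\ finite_set P, P `<=` S & partition P id A]].

Definition charge_join mu nu (A : set T) : \bar R :=
  ereal_sup [set \sum_(C \in P) maxe (mu C) (nu C) | P in finite_partitions A].

Definition charge_meet mu nu (A : set T) : \bar R :=
  ereal_inf [set \sum_(C \in P) mine (mu C) (nu C) | P in finite_partitions A].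

Definition charge_pospart mu : set T -> \bar R := charge_join mu (cst 0).

Definition charge_negpart mu : set T -> \bar R :=
  charge_join (fun A => - mu A) (cst 0).

Definition variation_of mu : set T -> \bar R :=
  charge_join mu (fun A => - mu A).

Definition charge_of_finite_variation mu : Prop :=
  finite_on (variation_of mu).

Definition minimal_decomposition mu nu1 nu2 : Prop :=
  [/\ charge_on nu1 /\ finite_on nu1,
      charge_on nu2 /\ finite_on nu2,
      (forall A, S A -> mu A = nu1 A - nu2 A)
    & (forall A, S A -> charge_meet nu1 nu2 A = 0)].

End set_functions.

(* Main.v *)
Require Import Defs.
From HB Require Import structures.
From mathcomp Require Import all_boot all_order all_algebra finmap.
From mathcomp Require Import all_classical all_reals all_analysis.
From mathcomp Require Import lra.

Import Order.TTheory GRing.Theory Num.Theory.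
Import numFieldNormedType.Exports.

Local Open Scope classical_set_scope.
Local Open Scope ereal_scope.

(** For a set function [f], let [J f A] be the supremum of
    [\sum_(C \in P) f C] over the finite partitions [P] of [A]; positive part,
    negative part and variation of [mu] are [J] of [max(mu, 0)], [max(-mu, 0)]
    and [max(mu, -mu)].

    Two facts about [J] carry the proof.

    - If [f] is nonnegative, vanishes at the empty set and is subadditive along
      a disjoint family [F], then [J f] is additive along [F]
      ([partition_sup_bigcup]).  For [<=], a partition [P] of the union is cut
      along the [F i]: its sum is at most the sum over [C] and [i] of
      [f (C `&` F i)], and for each fixed [i] the sets [C `&` F i] partition
      [F i].  For [>=], partitions of finitely many [F i] are completed to a
      partition of the whole, because the complement of a member of [S] in a
      finite disjoint union of members of [S] is again such a union.  As
      [max(mu, 0)] inherits finite, resp. countable, subadditivity from the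
      additivity of [mu], the positive part is a charge, resp. a measure, and
      the negative part is the positive part of [-mu].

    - If [mu] is finite and additive, every partition sum of [mu] over [A] is
      [mu A], so [J (mu + f) = mu + J f] on [S] ([partition_sup_addl]).  The
      algebra of real numbers then gives all the identities:
      [max(mu, 0) = mu + max(-mu, 0)] gives the first one,
      [max(mu, -mu) = mu + 2 max(-mu, 0)] the formula for the variation, and
      [min(nu1, nu2) = nu1 - max(nu1 - nu2, 0)] shows that the meet of two finite
      charges with difference [mu] is [nu1] minus the positive part of [mu].
      That last identity yields at once that the positive and negative parts
      are disjoint and that no other pair is: the meet vanishes exactly when
      [nu1] is the positive part. *)

(** * Suprema of extended reals *)

Section ereal_sup_lemmas.
Context {R : realType}.
Implicit Types (X Y : set (\bar R)) (a b : \bar R).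

Lemma ereal_sup_shift a X : a \is a fin_num ->
  ereal_sup [set a + x | x in X] = a + ereal_sup X.
Proof.
move=> afin; apply/eqP; rewrite eq_le; apply/andP; split.
  apply: ge_ereal_sup => _ [x Xx <-]; rewrite leeD2l//.
  exact: ereal_sup_ubound.
rewrite -leeBrDl//; apply: ge_ereal_sup => x Xx; rewrite leeBrDl//.
by apply: ereal_sup_ubound; exists x.
Qed.

Lemma ereal_supD_le X Y b : X !=set0 -> Y !=set0 ->
  (forall x, X x -> 0 <= x) -> (forall y, Y y -> 0 <= y) ->
  (forall x y, X x -> Y y -> x + y <= b) -> ereal_sup X + ereal_sup Y <= b.
Proof.
move=> [x0 Xx0] [y0 Yy0] X0 Y0 XYb.
(* An infinite [c] cannot be moved to the other side, but then any single
   element of [Z] already forces [b = +oo]. *)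
have sup_le (Z : set (\bar R)) z0 c : Z z0 -> (forall z, Z z -> 0 <= z) ->
    0 <= c -> (forall z, Z z -> z + c <= b) -> ereal_sup Z + c <= b.
  move=> Zz0 Z0 c0 Zb; case: c c0 Zb => [r| |]// c0 Zb.
    rewrite -leeBrDr//; apply: ge_ereal_sup => z Zz.
    by rewrite leeBrDr// Zb.
  have := Zb _ Zz0; rewrite addey; last first.
    by rewrite gt_eqF// (lt_le_trans _ (Z0 _ Zz0))// ltNy0.
  by rewrite leye_eq => /eqP ->; rewrite leey.
have supY0 : 0 <= ereal_sup Y.
  by rewrite (le_trans (Y0 _ Yy0))//; exact: ereal_sup_ubound.
apply: (sup_le _ x0) => // x Xx; rewrite addeC.
apply: (sup_le _ y0) => //; first exact: X0.
by move=> y Yy; rewrite addeC XYb.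
Qed.

End ereal_sup_lemmas.

(** * Finite partitions by members of the semi-ring *)

Section partitions.
Context {T : Type} {S : set (set T)}.
Implicit Types (A B : set T) (P Q : set (set T)).

(** Disjoint families arising from intersections contain empty members, which
    are not allowed as blocks; discarding them leaves a genuine partition, on
    which the indexing is injective. *)
Lemma finite_partitions_family (I : choiceType) (D : set I) (G : I -> set T) :
  finite_set D -> (forall i, D i -> S (G i)) -> trivIset D G ->
  finite_partitions S (\bigcup_(i in D) G i)
    (G @` (D `&` [set i | G i !=set0])).
Proof.
move=> Dfin SG tG; split.
- exact/finite_image/finite_setIl.
- by move=> _ [i [Di _] <-]; exact: SG.
split.
- apply/seteqP; split => x.
    by case=> _ [i [Di _] <-] Gx; exists i.
  case=> i Di Gx; exists (G i) => //; exists i => //; split=> //.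
  by exists x.
- move=> _ _ [i [Di _] <-] [j [Dj _] <-] ne.
  by rewrite (tG i j).
- by move=> _ [i [_ G0] <-].
Qed.

Lemma fsbig_family {R : realType} (I : choiceType) (D : set I) (G : I -> set T)
    (f : set T -> \bar R) : f set0 = 0 -> trivIset D G ->
  \sum_(C \in G @` (D `&` [set i | G i !=set0])) f C = \sum_(i \in D) f (G i).
Proof.
move=> f0 tG; rewrite fsbig_image.
  apply: fsbig_widen => [i []//|i [Di nG]] /=.
  suff -> : G i = set0 by [].
  apply: contrapT => /eqP/set0P Gi; exact: nG.
move=> i j /[!inE] -[Di [x Gix]] [Dj _] Gij.
by apply: tG => //; exists x; rewrite -Gij.
Qed.

Lemma finite_partitions_self A : S A -> finite_partitions S A !=set0.
Proof.
move=> SA.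
have := finite_partitions_family _ [set A] id (finite_set1 A) _ (@trivIset1 _ _ A id).
by rewrite bigcup_set1 => PA; eexists; apply: PA => _ ->.
Qed.

Lemma finite_partitionsU A B P Q : A `&` B = set0 ->
  finite_partitions S A P -> finite_partitions S B Q ->
  P `&` Q = set0 /\ finite_partitions S (A `|` B) (P `|` Q).
Proof.
move=> AB0 [Pfin PS [PA tP P0]] [Qfin QS [QB tQ Q0]].
have PQ C C' : P C -> Q C' -> C `&` C' !=set0 -> False.
  move=> PC QC' [x [Cx C'x]].
  have : (A `&` B) x by rewrite -PA -QB; split; [exists C|exists C'].
  by rewrite AB0.
split.
  rewrite -subset0 => C [PC QC]; apply: (PQ _ _ PC QC).
  by rewrite setIid; exact: P0.
split; first by rewrite finite_setU.
  by rewrite subUset.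
split; first by rewrite /cover bigcup_setU -PA -QB.
  move=> C C' [PC|QC] [PC'|QC'] ne.
  - exact: tP.
  - by case: (PQ _ _ PC QC' ne).
  - by rewrite setIC in ne; case: (PQ _ _ PC' QC ne).
  - exact: tQ.
by move=> C [/P0|/Q0].
Qed.

(** The sets that have a finite partition are stable under removing members of
    [S], since each block can be cut separately.  This is why the suprema below
    are taken over arbitrary sets rather than members of [S] only: members can
    be split off one after the other, although the remainder is not in [S]. *)
Lemma finite_partitions_setD A B : semi_setD_closed S ->
  finite_partitions S A !=set0 -> S B ->
  finite_partitions S (A `\` B) !=set0.
Proof.
move=> SD [P [Pfin PS [PA tP P0]]] SB.
have /choice[D DP] (C : set T) : exists D, P C ->
    [/\ finite_set D, D `<=` S, C `\` B = \bigcup_(X in D) X & trivIset D id].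
  have [PC|nPC] := pselect (P C); last by exists set0.
  by have [D HD] := SD _ _ (PS _ PC) SB; exists D.
pose E := \bigcup_(C in P) D C.
have DC C X : P C -> D C X -> X `<=` C `\` B.
  by move=> PC DX x Xx; have [_ _ -> _] := DP _ PC; exists X.
have -> : A `\` B = \bigcup_(X in E) id X.
  rewrite -PA; apply/seteqP; split=> x.
    move=> [[C PC Cx] nBx]; have [_ _ CB _] := DP _ PC.
    have : (C `\` B) x by split.
    by rewrite CB => -[X DX Xx]; exists X => //; exists C.
  move=> [X [C PC DX] Xx]; have [Cx nBx] := DC _ _ PC DX _ Xx.
  by split=> //; exists C.
suff PE : finite_set E /\ (forall X, E X -> S X) /\ trivIset E id.
  have [Efin [ES tE]] := PE.
  by eexists; exact: finite_partitions_family Efin ES tE.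
split; last split.
- by apply: bigcup_finite => // C /DP[].
- by move=> X [C /DP[_ DS _ _] /DS].
- move=> X Y [C PC DX] [C' PC' DY] [x [Xx Yx]].
  have CC' : C = C'.
    apply: tP => //; exists x; split.
      by have [] := DC _ _ PC DX _ Xx.
    by have [] := DC _ _ PC' DY _ Yx.
  rewrite -CC' in DY; have [_ _ _] := DP _ PC.
  by apply=> //; exists x.
Qed.

End partitions.

(** * Suprema of partition sums *)

Section esum_fintype.
Local Open Scope ring_scope.
Local Open Scope ereal_scope.

Lemma esum_fintype {R : realType} (I : finType) (a : I -> \bar R) :
  (forall i, 0 <= a i) -> \esum_(i in setT) a i = \sum_(i : I) a i.
Proof.
move=> a0; rewrite esum_fset; [|exact: finite_finset|by []].
rewrite [RHS](bigfs _ (index_enum_uniq _)) => [|i _]; last first.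
  by rewrite mem_index_enum.
by apply: eq_fsbigl; apply/seteqP; split.
Qed.

End esum_fintype.

Section partition_sup.
Local Open Scope ring_scope.
Local Open Scope ereal_scope.
Context {R : realType} {T : Type} (S : set (set T)).
Implicit Types (f g mu : set T -> \bar R) (A B : set T).

Definition partition_sup f A : \bar R :=
  ereal_sup [set \sum_(C \in P) f C | P in finite_partitions S A].

Lemma eq_partition_sup f g A : (forall C, S C -> f C = g C) ->
  partition_sup f A = partition_sup g A.
Proof.
move=> fg; congr ereal_sup; apply: eq_imagel => P [_ PS _].
by apply: eq_fsbigr => C /[!inE] /PS /fg.
Qed.

Lemma partition_sup_ge0 f A : (forall C, S C -> 0 <= f C) ->
  finite_partitions S A !=set0 -> 0 <= partition_sup f A.
Proof.
move=> f0 [P PA]; apply: (@le_trans _ _ (\sum_(C \in P) f C)).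
  by apply: fsume_ge0 => C; case: PA => _ + _ => /[apply]; exact: f0.
by apply: ereal_sup_ubound; exists P.
Qed.

Lemma partition_sup_set0 f : partition_sup f set0 = 0.
Proof.
rewrite /partition_sup (_ : [set _ | _ in _] = [set 0]) ?ereal_sup1//.
have sum0 P : finite_partitions S set0 P -> P = set0.
  move=> [_ _ [P0 _ Pne]]; rewrite -subset0 => C PC.
  have [x Cx] := Pne _ PC.
  have : cover P id x by exists C.
  by rewrite P0.
apply/seteqP; split=> [_ [P /sum0 -> <-]|_ ->] /=; first by rewrite fsbig_set0.
exists set0; last by rewrite fsbig_set0.
by split=> //; split; [rewrite /cover bigcup_set0|move=> ? ? []|].
Qed.

Lemma partition_sup_superadd f A B : (forall C, S C -> 0 <= f C) ->
  A `&` B = set0 ->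
  finite_partitions S A !=set0 -> finite_partitions S B !=set0 ->
  partition_sup f A + partition_sup f B <= partition_sup f (A `|` B).
Proof.
move=> f0 AB0 [P PA] [Q QB].
have sum0 D (x : \bar R) :
    [set \sum_(C \in P) f C | P in finite_partitions S D] x -> 0 <= x.
  by move=> [P' [_ PS _] <-]; apply: fsume_ge0 => C /PS; exact: f0.
apply: ereal_supD_le; [by eexists; exists P|by eexists; exists Q|exact: sum0..|].
move=> _ _ [P' PA' <-] [Q' QB' <-].
have [PQ0 PQ] := finite_partitionsU _ _ _ _ AB0 PA' QB'.
apply: ereal_sup_ubound; exists (P' `|` Q') => //.
rewrite fsbigU0//; [by case: PA'|by case: QB'|].
by rewrite PQ0.
Qed.

(** Split off [F i] for one index at a time; the remainder [A `\` F i] still has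
    a finite partition and contains the other members. *)
Lemma partition_sup_sum_le (I : eqType) (s : seq I) (F : I -> set T) f A :
  semi_setD_closed S -> (forall C, S C -> 0 <= f C) -> uniq s ->
  (forall i, i \in s -> S (F i)) -> trivIset [set` s] F ->
  (forall i, i \in s -> F i `<=` A) -> finite_partitions S A !=set0 ->
  \sum_(i <- s) partition_sup f (F i) <= partition_sup f A.
Proof.
move=> SD f0; elim: s A => [|i s IH] A /= => [_ _ _ _ PA|].
  by rewrite big_nil; exact: partition_sup_ge0.
move=> /andP[is_ us] SF tF FA PA; rewrite big_cons.
have si : i \in i :: s by rewrite mem_head.
have sj j : j \in s -> j \in i :: s by rewrite inE orbC => ->.
have AiE : A = F i `|` A `\` F i by rewrite setDUK//; exact: FA.
rewrite [X in _ <= partition_sup f X]AiE.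
have PAi : finite_partitions S (A `\` F i) !=set0.
  by apply: finite_partitions_setD => //; exact: SF.
apply: le_trans (partition_sup_superadd _ _ _ f0 _ _ PAi); last 2 first.
- by rewrite setDIK.
- exact/finite_partitions_self/SF.
rewrite leeD2l// IH//.
- by move=> j /sj; exact: SF.
- by move=> j k /sj js /sj ks; exact: tF.
- move=> j js x Fjx; split; first exact: (FA j (sj _ js)).
  move=> Fix; move: is_; rewrite (tF i j) ?js//=; first exact: sj.
  by exists x.
Qed.

(** Unordered sums make one statement serve both finite families, where it is
    finite additivity, and sequences, where it is countable additivity. *)
Lemma partition_sup_bigcup (I : choiceType) (D : set I) (F : I -> set T) f :
  semiring_of_sets S -> f set0 = 0 -> (forall C, S C -> 0 <= f C) ->
  (forall i, D i -> S (F i)) -> trivIset D F -> S (\bigcup_(i in D) F i) ->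
  (forall C, S C -> C `<=` \bigcup_(i in D) F i ->
    f C <= \esum_(i in D) f (C `&` F i)) ->
  partition_sup f (\bigcup_(i in D) F i) = \esum_(i in D) partition_sup f (F i).
Proof.
move=> [S0 SI SD] f0 fge0 SF tF SA subf.
apply/eqP; rewrite eq_le; apply/andP; split; last first.
  apply: ge_ereal_sup => _ [X [Xfin XD] <-]; rewrite fsbig_finite//.
  have XE i : (i \in fset_set X) = (i \in X) by rewrite in_fset_set.
  apply: partition_sup_sum_le => //.
  - by move=> i; rewrite XE inE => /XD; exact: SF.
  - by move=> i j /=; rewrite !XE !inE => /XD ? /XD ?; exact: tF.
  - by move=> i; rewrite XE inE => /XD Di x Fx; exists i.
  - exact: finite_partitions_self.
apply: ge_ereal_sup => _ [P [Pfin PS [PA tP P0]] <-].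
apply: (@le_trans _ _ (\sum_(C \in P) \esum_(i in D) f (C `&` F i))).
  apply: lee_fsum => // C PC; apply: subf; first exact: PS.
  by rewrite -PA => x Cx; exists C.
have PE C : (C \in fset_set P) -> P C by rewrite in_fset_set// inE.
rewrite fsbig_finite// big_seq_cond -esum_sum; last first.
  by move=> i C Di; rewrite andbT => /PE PC; apply/fge0/SI; [exact: PS|exact: SF].
apply: le_esum => i Di; rewrite -big_seq_cond -fsbig_finite//.
rewrite -(fsbig_family _ P (fun C => C `&` F i))//; last exact: trivIset_setIr.
apply: ereal_sup_ubound; eexists; last reflexivity.
have FE : \bigcup_(C in P) (C `&` F i) = F i.
  rewrite -setI_bigcupl; apply/setIidr.
  by rewrite -[X in _ `<=` X]/(cover P id) PA => x Fx; exists i.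
rewrite -[X in finite_partitions S X]FE.
apply: finite_partitions_family => //; last exact: trivIset_setIr.
by move=> C PC; apply: SI; [exact: PS|exact: SF].
Qed.


(** Finite additivity speaks of families indexed by ['I_n]; the blocks are
    listed to get such an indexing. *)
Lemma finitely_additive_finite_partitions mu A P : finitely_additive_on S mu ->
  S A -> finite_partitions S A P -> mu A = \sum_(C \in P) mu C.
Proof.
move=> mu_add SA [Pfin PS [PA tP P0]]; rewrite fsbig_finite//.
pose s : seq (set T) := fset_set P.
have sP C : C \in s -> P C by rewrite /s in_fset_set// inE.
have nth_s (i : 'I_(size s)) : nth set0 s i \in s by exact: mem_nth.
rewrite -[X in \sum_(_ <- X) _]/s (big_nth set0) big_mkord.
have AE : \bigcup_i nth set0 s (i : 'I_(size s)) = A.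
  rewrite -PA; apply/seteqP; split=> x.
    by move=> [i _ six]; exists (nth set0 s i) => //; exact/sP/nth_s.
  move=> [C PC Cx].
  have Cs : C \in s by rewrite /s in_fset_set// inE.
  have Ci : (index C s < size s)%N by rewrite index_mem.
  by exists (Ordinal Ci) => //=; rewrite nth_index.
rewrite -[in LHS]AE mu_add ?AE//.
  by move=> i; exact/PS/sP/nth_s.
move=> i j _ _ ne; apply/val_inj/eqP.
rewrite -(nth_uniq set0 (ltn_ord i) (ltn_ord j) (fset_uniq _)).
by apply/eqP; apply: tP => //; exact/sP/nth_s.
Qed.

(** The partition sums of an additive function do not depend on the
    partition, so such a function passes through the supremum as a constant. *)
Lemma partition_sup_addl mu f A : finitely_additive_on S mu ->
  finite_on S mu -> S A ->
  partition_sup (fun C => mu C + f C) A = mu A + partition_sup f A.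
Proof.
move=> mu_add mu_fin SA; rewrite -ereal_sup_shift; last exact: mu_fin.
rewrite image_comp; congr ereal_sup; apply: eq_imagel => P PA /=.
rewrite (finitely_additive_finite_partitions _ _ _ mu_add SA PA) fsbig_split//.
by case: PA.
Qed.

Lemma partition_sup_charge f : semiring_of_sets S -> f set0 = 0 ->
  (forall C, S C -> 0 <= f C) ->
  (forall n (F : 'I_n -> set T), (forall i, S (F i)) -> trivIset setT F ->
     S (\bigcup_i F i) -> f (\bigcup_i F i) <= \sum_(i < n) f (F i)) ->
  charge_on S (partition_sup f).
Proof.
move=> Ssr f0 fge0 subf.
have ge0 A : S A -> 0 <= partition_sup f A.
  by move=> SA; apply: partition_sup_ge0 => //; exact: finite_partitions_self.
split; last exact: ge0.
split; [exact: partition_sup_set0| |].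
  by right=> A /ge0; apply: contraTneq => ->.
move=> n F SF tF SA; rewrite partition_sup_bigcup//.
  by rewrite esum_fintype// => i; exact: ge0.
move=> C SC CF; have [_ SI _] := Ssr.
have CE : \bigcup_i (C `&` F i) = C by rewrite -setI_bigcupr; exact/setIidl.
rewrite -[in leLHS]CE.
rewrite esum_fintype; last by move=> i; exact/fge0/SI.
apply: subf; rewrite ?CE//; last exact: trivIset_setIl.
by move=> i; exact: SI.
Qed.

Lemma partition_sup_countably_additive f : semiring_of_sets S -> f set0 = 0 ->
  (forall C, S C -> 0 <= f C) ->
  (forall F : (set T)^nat, (forall i, S (F i)) -> trivIset setT F ->
     S (\bigcup_i F i) -> f (\bigcup_i F i) <= \sum_(i <oo) f (F i)) ->
  countably_additive_on S (partition_sup f).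
Proof.
move=> Ssr f0 fge0 subf F SF tF SA; have [_ SI _] := Ssr.
have ge0 A : S A -> 0 <= partition_sup f A.
  by move=> SA'; apply: partition_sup_ge0 => //; exact: finite_partitions_self.
rewrite partition_sup_bigcup//.
  rewrite -nneseries_esumT; last by move=> n; exact: ge0.
  by apply: is_cvg_nneseries => n _ _; exact: ge0.
move=> C SC CF; rewrite -nneseries_esumT; last by move=> n; exact/fge0/SI.
have CE : \bigcup_i (C `&` F i) = C by rewrite -setI_bigcupr; exact/setIidl.
rewrite -[in leLHS]CE; apply: subf; rewrite ?CE//; last exact: trivIset_setIl.
by move=> i; exact: SI.
Qed.

End partition_sup.

(** * Positive part, negative part and variation *)

Section pospart.
Context {R : realType} {T : Type} (S : set (set T)).
Local Open Scope ring_scope.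
Local Open Scope ereal_scope.
Implicit Types (mu nu : set T -> \bar R) (A B : set T).

Lemma charge_pospart_charge mu : semiring_of_sets S -> signed_charge_on S mu ->
  charge_on S (charge_pospart S mu).
Proof.
move=> Ssr [mu0 _ mu_add].
rewrite -[charge_pospart S mu]/(partition_sup S (fun C => maxe (mu C) 0)).
apply: partition_sup_charge => //.
- by rewrite mu0 maxxx.
- by move=> C _; rewrite le_max lexx orbT.
move=> n F SF tF SA; rewrite mu_add// ge_max; apply/andP; split.
  by apply: lee_sum => i _; rewrite le_max lexx.
by apply: sume_ge0 => i _; rewrite le_max lexx orbT.
Qed.

(** Countable subadditivity of [max(mu, 0)]: the partial sums of [mu] along [F]
    converge to [mu (\bigcup_i F i)] and stay below those of [max(mu, 0)]. *)
Lemma charge_pospart_measure mu : semiring_of_sets S ->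
  signed_measure_on S mu -> measure_on S (charge_pospart S mu).
Proof.
move=> Ssr [mu_sc mu_sadd]; split; first exact: charge_pospart_charge.
have [mu0 _ _] := mu_sc.
rewrite -[charge_pospart S mu]/(partition_sup S (fun C => maxe (mu C) 0)).
apply: partition_sup_countably_additive => //.
- by rewrite mu0 maxxx.
- by move=> C _; rewrite le_max lexx orbT.
have max0 C : 0 <= maxe (mu C) 0 by rewrite le_max lexx orbT.
move=> F SF tF SA; rewrite ge_max nneseries_ge0// andbT.
have mu_cvg := mu_sadd F SF tF SA.
rewrite -(cvg_lim _ mu_cvg)//; apply: lime_le.
  by apply/cvg_ex; eexists; exact: mu_cvg.
apply: nearW => n; apply: le_trans (nneseries_lim_ge n _) => //.
by apply: lee_sum => i _; rewrite le_max lexx.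
Qed.

Lemma signed_charge_onN mu : finite_on S mu -> signed_charge_on S mu ->
  signed_charge_on S (fun A => - mu A).
Proof.
move=> mu_fin [mu0 _ mu_add]; split; first by rewrite mu0 oppe0.
  by left=> A /mu_fin; case: (mu A).
by move=> n F SF tF SA; rewrite mu_add// fin_num_sumeN// => i _; exact: mu_fin.
Qed.

Lemma signed_measure_onN mu : finite_on S mu -> signed_measure_on S mu ->
  signed_measure_on S (fun A => - mu A).
Proof.
move=> mu_fin [mu_sc mu_sadd]; split; first exact: signed_charge_onN.
move=> F SF tF SA.
have sumN : (fun n => \sum_(0 <= i < n) - mu (F i)) =
            (fun n => - \sum_(0 <= i < n) mu (F i)).
  by apply/funext => n; rewrite fin_num_sumeN// => i _; exact: mu_fin.
by rewrite sumN; apply: cvgeN; exact: mu_sadd.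
Qed.

(** From [max(mu, 0) = mu + max(-mu, 0)]. *)
Lemma charge_pospartE mu A : finite_on S mu -> signed_charge_on S mu -> S A ->
  charge_pospart S mu A = mu A + charge_negpart S mu A.
Proof.
move=> mu_fin [_ _ mu_add] SA.
rewrite -[charge_negpart _ _ _]/(partition_sup S (fun C => maxe (- mu C) 0) A).
rewrite -partition_sup_addl//; apply: eq_partition_sup => C /mu_fin muC.
by rewrite adde_maxr ?subee// adde0 maxC.
Qed.

(** From [max(mu, -mu) = mu + 2 max(-mu, 0)]. *)
Lemma variation_ofE mu A : finite_on S mu -> signed_charge_on S mu -> S A ->
  variation_of S mu A = charge_pospart S mu A + charge_negpart S mu A.
Proof.
move=> mu_fin mu_sc SA; rewrite charge_pospartE// -addeA.
have [_ _ mu_add] := mu_sc.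
rewrite -mule2n -mule_natl -ereal_sup_pZl// image_comp.
transitivity (mu A + partition_sup S (fun C => 2%:E * maxe (- mu C) 0) A).
  rewrite -partition_sup_addl//; apply: eq_partition_sup => C /mu_fin.
  case: (mu C) => // r _ /=; rewrite -!EFin_max -EFinM -EFinD.
  congr EFin; rewrite /Num.max; do 2 case: ifPn; rewrite -?leNgt; lra.
congr (_ + ereal_sup _); apply: eq_imagel => P [Pfin _ _] /=.
by rewrite ge0_mule_fsumr// => C; rewrite le_max lexx orbT.
Qed.

(** From [min(nu1, nu2) = nu1 - max(nu1 - nu2, 0)].  Since the right-hand side
    determines [nu1] when the meet vanishes, this gives both the disjointness
    of the positive and negative parts and the uniqueness of the
    decomposition. *)
Lemma charge_meetE mu nu1 nu2 A : finitely_additive_on S nu1 ->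
  finite_on S nu1 -> finite_on S nu2 ->
  (forall C, S C -> mu C = nu1 C - nu2 C) -> S A ->
  charge_meet S nu1 nu2 A = nu1 A - charge_pospart S mu A.
Proof.
move=> nu1_add nu1_fin nu2_fin muE SA.
rewrite /charge_meet ereal_infEN image_comp.
transitivity (- partition_sup S (fun C => - nu1 C + maxe (mu C) 0) A).
  congr (- ereal_sup _); apply: eq_imagel => P [Pfin PS _] /=.
  have SP C : C \in fset_set P -> S C by rewrite in_fset_set// inE => /PS.
  rewrite !fsbig_finite// !big_seq -fin_num_sumeN => [|C /SP SC]; last first.
    by rewrite /mine; case: ifP => _; [exact: nu1_fin|exact: nu2_fin].
  apply: eq_bigr => C /SP SC; rewrite muE//.
  move: (nu1_fin _ SC) (nu2_fin _ SC).
  case: (nu1 C) => // r _; case: (nu2 C) => // q _.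
  rewrite -?EFinN -EFinD -!EFin_max -EFin_min -EFinD -?EFinN; congr EFin.
  by rewrite /Num.max /Num.min; do 2 case: ifPn; rewrite -?leNgt; lra.
have nu1N_add : finitely_additive_on S (fun C => - nu1 C).
  move=> n F SF tF SA'; rewrite nu1_add// fin_num_sumeN// => i _.
  exact/nu1_fin/SF.
rewrite partition_sup_addl// => [|C /nu1_fin]; last by rewrite fin_numN.
by rewrite [in LHS]addeC fin_num_oppeD ?oppeK 1?addeC// fin_numN; exact: nu1_fin.
Qed.

End pospart.

Theorem theorem6p1 (R : realType) (T : Type) (S : set (set T))
    (mu : set T -> \bar R) :
  semiring_of_sets S -> signed_charge_on S mu -> finite_on S mu ->
  [/\ [/\ charge_on S (charge_pospart S mu),
          charge_on S (charge_negpart S mu),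
          forall A, S A -> charge_pospart S mu A = mu A + charge_negpart S mu A
        & forall A, S A ->
            variation_of S mu A = charge_pospart S mu A + charge_negpart S mu A],
      signed_measure_on S mu ->
        measure_on S (charge_pospart S mu) /\
        measure_on S (charge_negpart S mu),
      finite_on S (charge_pospart S mu) <-> finite_on S (charge_negpart S mu)
    & finite_on S (charge_pospart S mu) \/ finite_on S (charge_negpart S mu) ->
        [/\ charge_of_finite_variation S mu,
            minimal_decomposition S mu (charge_pospart S mu) (charge_negpart S mu)
          & forall nu1 nu2 : set T -> \bar R,
              minimal_decomposition S mu nu1 nu2 ->
              forall A, S A ->
                nu1 A = charge_pospart S mu A /\ nu2 A = charge_negpart S mu A]].
Proof.
move=> Ssr mu_sc mu_fin.
have muN_sc := signed_charge_onN _ _ mu_fin mu_sc.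
have posE A (SA : S A) := charge_pospartE _ _ _ mu_fin mu_sc SA.
have varE A (SA : S A) := variation_ofE _ _ _ mu_fin mu_sc SA.
have pos_ch : charge_on S (charge_pospart S mu) by exact: charge_pospart_charge.
have neg_ch : charge_on S (charge_negpart S mu) by exact: charge_pospart_charge.
have fin_iff : finite_on S (charge_pospart S mu) <->
               finite_on S (charge_negpart S mu).
  by split=> fin A SA; have := fin A SA; rewrite posE// fin_numD mu_fin.
split=> //.
  move=> mu_sm; split; first exact: charge_pospart_measure.
  exact/charge_pospart_measure/signed_measure_onN.
move=> fin_or.
have pos_fin : finite_on S (charge_pospart S mu).
  by case: fin_or => // /fin_iff.
have neg_fin := fin_iff.1 pos_fin.
have muE A : S A -> mu A = charge_pospart S mu A - charge_negpart S mu A.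
  by move=> SA; rewrite posE// addeK//; exact: neg_fin.
split.
- by move=> A SA; rewrite varE// fin_numD pos_fin// neg_fin.
- split=> // A SA.
  have [[_ _ pos_add] _] := pos_ch.
  rewrite (charge_meetE _ mu)// subee//; exact: pos_fin.
move=> nu1 nu2 [[[[_ _ nu1_add] _] nu1_fin] [_ nu2_fin] nuE meet0] A SA.
have nu1E : nu1 A = charge_pospart S mu A.
  have := meet0 A SA; rewrite (charge_meetE _ mu)// => /eqP.
  by rewrite sube_eq ?add0e ?nu1_fin ?fin_num_adde_defl ?pos_fin// => /eqP.
split=> //; move: (posE A SA); rewrite -nu1E nuE//.
move: (nu1_fin _ SA) (nu2_fin _ SA) (neg_fin _ SA).
case: (nu1 A) => // r _; case: (nu2 A) => // q _.
case: (charge_negpart S mu A) => // p _ [rqp].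
congr EFin; lra.
Qed.
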